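(* Let $\mathbf{k}$ be a commutative unital ring, $\Omega$ a nonempty set and $X$ a set disjoint from $\Omega$. The pair $(H_{RT}(X,\Omega),\Delta_\epsilon)$ is a coalgebra (without counit), i.e. $\Delta_\epsilon$ is coassociative: $(\mathrm{id}\otimes\Delta_\epsilon)\Delta_\epsilon=(\Delta_\epsilon\otimes\mathrm{id})\Delta_\epsilon$.
   Context: A coalgebra here is a coassociative coalgebra, not required to have a counit. A planar rooted tree is a finite rooted tree with a fixed embedding in the plane (so the children of each vertex are ordered from left to right). $\mathcal{T}(X,\Omega)$ is the set of planar rooted trees with vertices decorated by $X\sqcup\Omega$ such that all internal (non-leaf) vertices are decorated by elements of $\Omega$, while leaves may be decorated by any element of $X\sqcup\Omega$; the vertex of a one-vertex tree counts as a leaf. $\mathcal{F}(X,\Omega)$ is the free monoid on $\mathcal{T}(X,\Omega)$ under concatenation $m_{RT}$ (written as juxtaposition), with unit the empty tree $\mathbf{1}$. $H_{RT}(X,\Omega):=\mathbf{k}\mathcal{F}(X,\Omega)$ is the free $\mathbf{k}$-module on $\mathcal{F}(X,\Omega)$, with multiplication the linear extension of $m_{RT}$. For $\omega\in\Omega$, $B_\omega^+:H_{RT}(X,\Omega)\to H_{RT}(X,\Omega)$ is the linear map sending $\mathbf{1}$ to the one-vertex tree $\bullet_\omega$ and a forest to the tree obtained by grafting its trees (in order) on a new root decorated by $\omega$. For an algebra $A$, $a\cdot(b\otimes c)=ab\otimes c$ and $(b\otimes c)\cdot a=b\otimes ca$ on $A\otimes A$. The linear map $\Delta_\epsilon:H_{RT}(X,\Omega)\to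 H_{RT}(X,\Omega)\otimes H_{RT}(X,\Omega)$ is defined recursively by: $\Delta_\epsilon(\mathbf{1})=0$; $\Delta_\epsilon(\bullet_x)=\mathbf{1}\otimes\mathbf{1}$ for $x\in X$; $\Delta_\epsilon(B_\omega^+(\overline F))=\overline F\otimes\mathbf{1}+(\mathrm{id}\otimes B_\omega^+)\Delta_\epsilon(\overline F)$ for $\overline F\in\mathcal{F}(X,\Omega)$, $\omega\in\Omega$; and $\Delta_\epsilon(T_1\cdots T_m)=T_1\cdot\Delta_\epsilon(T_2\cdots T_m)+\Delta_\epsilon(T_1)\cdot(T_2\cdots T_m)$ for $m\geq2$, $T_i\in\mathcal{T}(X,\Omega)$. *)

(* Defs.v *)
From HB Require Import structures.
From mathcomp Require Import all_boot all_algebra finmap.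
From mathcomp.classical Require boolp.
From mathcomp.multinomials Require Import monalg.

Set Implicit Arguments.
Unset Strict Implicit.
Unset Printing Implicit Defensive.

Import GRing.Theory.
Local Open Scope ring_scope.
Local Open Scope quotient_scope.

(* Coefficients range over [comPzRingType], so that the zero
   ring is allowed. *)

(* The additive group of finitely supported functions [K -> k] is the one of
   [malg]; the scaling of [monalg.v] is only available over nonzero rings. *)
Definition freemod (k : comPzRingType) (K : choiceType) : Type := {malg k[K]}.

HB.instance Definition _ (k : comPzRingType) (K : choiceType) :=
  GRing.Zmodule.on (freemod k K).

Section FreeModule.
Variables (k : comPzRingType) (K : choiceType).
Implicit Types (f g : freemod k K) (c : k).

Definition fscale c f : freemod k K := [malg x in msupp f => c * f@_x].

Lemma fscaleE c f x : (fscale c f)@_x = c * f@_x.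
Proof. by rewrite mcoeffE; case: msuppP; rewrite ?mulr0. Qed.

Lemma fscaleA c d f : fscale c (fscale d f) = fscale (c * d) f.
Proof. by apply/malgP=> x; rewrite !fscaleE mulrA. Qed.

Lemma fscale1 : left_id 1 fscale.
Proof. by move=> f; apply/malgP=> x; rewrite fscaleE mul1r. Qed.

Lemma fscaleDr : right_distributive fscale +%R.
Proof.
by move=> c f g; apply/malgP=> x; rewrite mcoeffD !fscaleE mcoeffD mulrDr.
Qed.

Lemma fscaleDl f : {morph fscale^~ f : c d / c + d}.
Proof. by move=> c d; apply/malgP=> x; rewrite mcoeffD !fscaleE mulrDl. Qed.

HB.instance Definition _ := GRing.Zmodule_isLmodule.Build k (freemod k K)
  fscaleA fscale1 fscaleDr fscaleDl.

Lemma fcoeffZ c f x : (c *: f : freemod k K)@_x = c * f@_x.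
Proof. exact: fscaleE. Qed.

Definition gen (x : K) : freemod k K := << 1 *g x >>.

Lemma fcoeffgen x y : (gen x)@_y = (x == y)%:R.
Proof. exact: mcoeffU. Qed.

Lemma freemodE f : f = \sum_(x <- msupp f) f@_x *: gen x.
Proof.
rewrite {1}[f]monalgE; apply: eq_bigr => x _; apply/malgP=> y.
by rewrite fcoeffZ fcoeffgen mcoeffU mulr_natr.
Qed.

Variable V : lmodType k.
Implicit Types v w : K -> V.

Definition linext v f : V := \sum_(x <- msupp f) f@_x *: v x.

Lemma linextEw v f (d : {fset K}) : (msupp f `<=` d)%fset ->
  linext v f = \sum_(x <- d) f@_x *: v x.
Proof.
move=> sfd; rewrite /linext (big_fset_incl _ sfd) // => x _ xf.
by rewrite mcoeff_outdom // scale0r.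
Qed.

Lemma linext_is_linear v : linear (linext v).
Proof.
move=> c f g.
pose d := (msupp f `|` msupp g `|` msupp (c *: f + g : freemod k K))%fset.
have sub : (msupp (c *: f + g : freemod k K) `<=` d)%fset by apply: fsubsetUr.
have sf : (msupp f `<=` d)%fset by rewrite /d -fsetUA fsubsetUl.
have sg : (msupp g `<=` d)%fset.
  by rewrite /d (fsetUC (msupp f)) -fsetUA fsubsetUl.
rewrite (linextEw _ sub) (linextEw _ sf) (linextEw _ sg).
rewrite scaler_sumr -big_split /=; apply: eq_bigr => x _.
by rewrite mcoeffD fcoeffZ scalerDl scalerA.
Qed.

HB.instance Definition _ v :=
  GRing.isLinear.Build k (freemod k K) V *:%R (linext v) (linext_is_linear v).

Lemma linext_gen v x : linext v (gen x) = v x.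
Proof.
rewrite (@linextEw _ _ [fset x]%fset) ?msuppU_le //.
by rewrite big_seq_fset1 fcoeffgen eqxx scale1r.
Qed.

Lemma eq_freemod_linear (h h' : {linear freemod k K -> V}) :
  (forall x, h (gen x) = h' (gen x)) -> h =1 h'.
Proof.
move=> eqh f; rewrite [f]freemodE !linear_sum; apply: eq_bigr => x _.
by rewrite !linearZ eqh.
Qed.

Lemma linext_lin c v w f :
  linext (fun x => c *: v x + w x) f = c *: linext v f + linext w f.
Proof.
rewrite /linext scaler_sumr -big_split /=; apply: eq_bigr => x _.
by rewrite scalerDr !scalerA mulrC.
Qed.

End FreeModule.

Section Bilinear.
Variables (k : comPzRingType) (U V W : lmodType k).

Definition bilinear_map (f : U -> V -> W) : Prop :=
  (forall v, linear (fun u => f u v)) /\ (forall u, linear (f u)).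

End Bilinear.

Section Tensor.
Variables (k : comPzRingType) (U V : lmodType k).

Local Notation FM := (freemod k (U * V)%type).

Inductive tensor_rel : FM -> Prop :=
| TensorRel0 : tensor_rel 0
| TensorRelLin c x y :
    tensor_rel x -> tensor_rel y -> tensor_rel (c *: x + y)
| TensorRelDl u u' v :
    tensor_rel (gen k (u + u', v) - gen k (u, v) - gen k (u', v))
| TensorRelDr u v v' :
    tensor_rel (gen k (u, v + v') - gen k (u, v) - gen k (u, v'))
| TensorRelZl c u v :
    tensor_rel (gen k (c *: u, v) - c *: gen k (u, v))
| TensorRelZr c u v :
    tensor_rel (gen k (u, c *: v) - c *: gen k (u, v)).

Definition tensor_relb : {pred FM} := fun x => boolp.asbool (tensor_rel x).

Lemma tensor_relP x : reflect (tensor_rel x) (x \in tensor_relb).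
Proof. exact: boolp.asboolP. Qed.

Lemma tensor_relZ c x : tensor_rel x -> tensor_rel (c *: x).
Proof. by move=> hx; rewrite -[_ *: _]addr0; apply: TensorRelLin hx TensorRel0. Qed.

Lemma tensor_relb_zmod : zmod_closed tensor_relb.
Proof.
split=> [|x y /tensor_relP hx /tensor_relP hy]; apply/tensor_relP.
  exact: TensorRel0.
by rewrite addrC -scaleN1r; apply: TensorRelLin.
Qed.

HB.instance Definition _ :=
  GRing.isZmodClosed.Build FM tensor_relb tensor_relb_zmod.

Definition tensor : Type := Quotient.quot tensor_relb.
HB.instance Definition _ := GRing.Zmodule.on tensor.
HB.instance Definition _ := EqQuotient.on tensor.

Definition tproj (x : FM) : tensor := \pi_tensor x.

Lemma tproj_eq x y : tensor_rel (x - y) <-> tproj x = tproj y.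
Proof.
split=> [h|/eqP].
  by apply/eqP; rewrite /tproj -Quotient.idealrBE; apply/tensor_relP.
by rewrite /tproj -Quotient.idealrBE => /tensor_relP.
Qed.

Lemma tprojK t : tproj (repr t) = t.
Proof. exact: reprK. Qed.

Lemma tprojD x y : tproj (x + y) = tproj x + tproj y.
Proof. by rewrite /tproj !piE. Qed.

Definition tscale c (t : tensor) : tensor := tproj (c *: repr t).

Lemma tproj_scale c x : tscale c (tproj x) = tproj (c *: x).
Proof.
apply/tproj_eq; rewrite -scalerBr; apply: tensor_relZ.
by apply/tproj_eq; rewrite tprojK.
Qed.

Lemma tscaleA c d t : tscale c (tscale d t) = tscale (c * d) t.
Proof. by rewrite -[t]tprojK !tproj_scale scalerA. Qed.

Lemma tscale1 : left_id 1 tscale.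
Proof. by move=> t; rewrite -[t]tprojK tproj_scale scale1r. Qed.

Lemma tscaleDr : right_distributive tscale +%R.
Proof.
move=> c t t'.
by rewrite -[t]tprojK -[t']tprojK -tprojD !tproj_scale scalerDr tprojD.
Qed.

Lemma tscaleDl t : {morph tscale^~ t : c d / c + d}.
Proof. by move=> c d; rewrite -[t]tprojK !tproj_scale scalerDl tprojD. Qed.

HB.instance Definition _ := GRing.Zmodule_isLmodule.Build k tensor
  tscaleA tscale1 tscaleDr tscaleDl.

Lemma tproj_is_linear : linear tproj.
Proof. by move=> c x y; rewrite tprojD -tproj_scale. Qed.

HB.instance Definition _ :=
  GRing.isLinear.Build k FM tensor *:%R tproj tproj_is_linear.

Definition tens (u : U) (v : V) : tensor := tproj (gen k (u, v)).

Lemma tproj0 x : tensor_rel x -> tproj x = 0.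
Proof. by move=> hx; rewrite -[RHS](linear0 tproj); apply/tproj_eq; rewrite subr0. Qed.

Lemma tens_bilinear : bilinear_map tens.
Proof.
split=> [v c u u' /=|u c v v'].
- have /tproj0/eqP := TensorRelDl (c *: u) u' v.
  rewrite !linearB /= -addrA -opprD subr_eq0 => /eqP; rewrite -!/(tens _ _) => ->.
  have /tproj0/eqP := TensorRelZl c u v.
  by rewrite linearB linearZ /= subr_eq0 -!/(tens _ _) => /eqP ->.
- have /tproj0/eqP := TensorRelDr u (c *: v) v'.
  rewrite !linearB /= -addrA -opprD subr_eq0 => /eqP; rewrite -!/(tens _ _) => ->.
  have /tproj0/eqP := TensorRelZr c u v.
  by rewrite linearB linearZ /= subr_eq0 -!/(tens _ _) => /eqP ->.
Qed.

End Tensor.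

Notation "U ⊗M V" := (tensor U V)
  (at level 40, left associativity) : type_scope.
Notation "u ⊗ v" := (tens u v)
  (at level 40, left associativity) : ring_scope.

Section TensorLift.
Variables (k : comPzRingType) (U V W : lmodType k).

Definition tlift (f : U -> V -> W) (hf : bilinear_map f) (t : tensor U V) : W :=
  linext (fun p : U * V => f p.1 p.2) (repr t).

Section Lift.
Variables (f : U -> V -> W) (hf : bilinear_map f).

Lemma tlift_proj x : tlift hf (tproj x) = linext (fun p => f p.1 p.2) x.
Proof.
suff lift0 z : tensor_rel z -> linext (fun p : U * V => f p.1 p.2) z = 0.
  apply/eqP; rewrite -subr_eq0 -linearB; apply/eqP/lift0.
  by apply/tproj_eq; rewrite tprojK.
have [hl hr] := hf.
elim=> {z} [|c y z _ hy _ hz|u u' v|u v v'|c u v|c u v].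
- exact: linear0.
- by rewrite linearP /= hy hz scaler0 addr0.
- rewrite !linearB /= !linext_gen /=.
  by have := hl v 1 u u'; rewrite !scale1r => ->; rewrite -addrA -opprD subrr.
- rewrite !linearB /= !linext_gen /=.
  by have := hr u 1 v v'; rewrite !scale1r => ->; rewrite -addrA -opprD subrr.
- rewrite linearB linearZ /= !linext_gen /=.
  have h0 : f 0 v = 0 by have := hl v (-1) 0 0; rewrite scaler0 addr0 scaleN1r addNr.
  by have := hl v c u 0; rewrite !addr0 h0 addr0 => ->; rewrite subrr.
- rewrite linearB linearZ /= !linext_gen /=.
  have h0 : f u 0 = 0 by have := hr u (-1) 0 0; rewrite scaler0 addr0 scaleN1r addNr.
  by have := hr u c v 0; rewrite !addr0 h0 addr0 => ->; rewrite subrr.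
Qed.

Lemma tlift_is_linear : linear (tlift hf).
Proof.
move=> c t t'; rewrite -[t]tprojK -[t']tprojK -linearP.
by rewrite !tlift_proj linearP.
Qed.

HB.instance Definition _ :=
  GRing.isLinear.Build k (tensor U V) W *:%R (tlift hf) tlift_is_linear.

Lemma tlift_tens u v : tlift hf (u ⊗ v) = f u v.
Proof. by rewrite tlift_proj linext_gen. Qed.

End Lift.

Lemma eq_tensor_linear (h h' : {linear tensor U V -> W}) :
  (forall u v, h (u ⊗ v) = h' (u ⊗ v)) -> h =1 h'.
Proof.
move=> eqh t; rewrite -[t]tprojK [repr t]freemodE !linear_sum.
by apply: eq_bigr => -[u v] _; rewrite !linearZ /= eqh.
Qed.

Lemma tlift_lin (f g h : U -> V -> W) (hf : bilinear_map f)
    (hg : bilinear_map g) (hh : bilinear_map h) c :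
  (forall u v, h u v = c *: f u v + g u v) ->
  forall t, tlift hh t = c *: tlift hf t + tlift hg t.
Proof.
move=> eqh t; rewrite /tlift -linext_lin.
by apply: eq_bigr => -[u v] _; rewrite eqh.
Qed.

End TensorLift.

Section TensorMap.
Variables (k : comPzRingType) (U V U' V' : lmodType k).
Variables (f : {linear U -> U'}) (g : {linear V -> V'}).

Lemma tmap_bilinear : bilinear_map (fun u v => f u ⊗ g v).
Proof.
split=> [v c u u' /=|u c v v'] /=; rewrite linearP.
  exact: (tens_bilinear U' V').1.
exact: (tens_bilinear U' V').2.
Qed.

Definition tmap : {linear tensor U V -> tensor U' V'} := tlift tmap_bilinear.

Lemma tmap_tens u v : tmap (u ⊗ v) = f u ⊗ g v.
Proof. exact: tlift_tens. Qed.

End TensorMap.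

Section TensorAssoc.
Variables (k : comPzRingType) (U V W : lmodType k).

Lemma tassoc1_bilinear (w : W) : bilinear_map (fun (u : U) (v : V) => u ⊗ (v ⊗ w)).
Proof.
split=> [v c u u' /=|u c v v']; first exact: (tens_bilinear _ _).1.
by rewrite (tens_bilinear _ _).1 (tens_bilinear _ _).2.
Qed.

Lemma tassoc_bilinear :
  bilinear_map (fun (t : tensor U V) (w : W) => tlift (tassoc1_bilinear w) t).
Proof.
split=> [w c t t' /=|t c w w']; first exact: linearP.
by apply: tlift_lin => u v; rewrite !(tens_bilinear _ _).2.
Qed.

Definition tassoc : {linear (U ⊗M V) ⊗M W -> U ⊗M (V ⊗M W)} :=
  tlift tassoc_bilinear.

Lemma tassoc_tens u v w : tassoc ((u ⊗ v) ⊗ w) = u ⊗ (v ⊗ w).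
Proof. by rewrite /tassoc /= !tlift_tens. Qed.

End TensorAssoc.

(* A coalgebra without counit is a module [C] with a linear map
   [C -> C ⊗M C] that is coassociative. *)
Definition coassociative (k : comPzRingType) (C : lmodType k)
    (Delta : {linear C -> C ⊗M C}) : Prop :=
  forall x : C,
    tmap idfun Delta (Delta x) = tassoc C C C (tmap Delta idfun (Delta x)).

(* [Node w F] is the tree with root decorated by [w] and ordered list of
   branches [F]; in particular [Node w [::]] is the one-vertex tree decorated
   by [w].  Using two constructors makes the union of [X] and [Omega] disjoint
   and restricts decorations from [X] to leaves. *)
Inductive tree (X Omega : Type) : Type :=
| Leaf of X
| Node of Omega & seq (tree X Omega).
Arguments Leaf {X Omega}.
Arguments Node {X Omega}.

Section TreeChoice.
Variables X Omega : choiceType.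

Fixpoint tree_encode (t : tree X Omega) : GenTree.tree (X + Omega) :=
  match t with
  | Leaf x => GenTree.Leaf (inl x)
  | Node w F => GenTree.Node 0 (GenTree.Leaf (inr w) :: map tree_encode F)
  end.

Fixpoint tree_decode (t : GenTree.tree (X + Omega)) : option (tree X Omega) :=
  match t with
  | GenTree.Leaf (inl x) => Some (Leaf x)
  | GenTree.Node 0 (GenTree.Leaf (inr w) :: F) =>
      Some (Node w (pmap tree_decode F))
  | _ => None
  end.

Lemma tree_encodeK : pcancel tree_encode tree_decode.
Proof.
rewrite /pcancel; fix IH 1; case=> [x|w F] //=; congr (Some (Node w _)).
by elim: F => [|t F IHF] //=; rewrite IH /= IHF.
Qed.

HB.instance Definition _ := Choice.copy (tree X Omega) (pcan_type tree_encodeK).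

End TreeChoice.

(* Forests, i.e. elements of the free monoid on trees, are lists of trees. *)
Notation forest X Omega := (seq (tree X Omega)).

Definition HRT (k : comPzRingType) (X Omega : choiceType) : Type :=
  freemod k (forest X Omega).

Section HRTAlgebra.
Variables (k : comPzRingType) (X Omega : choiceType).
Local Notation H := (HRT k X Omega).

HB.instance Definition _ := GRing.Lmodule.on H.

Definition of_forest (F : forest X Omega) : H := gen k F.

Definition hmul (f g : H) : H :=
  linext (fun F => linext (fun G => of_forest (F ++ G)) g) f.

Definition hmulr (g f : H) : H := hmul f g.

Lemma hmul_linearl g : linear (hmulr g).
Proof. by move=> c f f'; rewrite /hmulr /hmul linearP. Qed.

Lemma hmul_linearr f : linear (hmul f).
Proof.
move=> c g g'; rewrite /hmul -linext_lin.
by apply: eq_bigr => F _; rewrite linearP.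
Qed.

HB.instance Definition _ f :=
  GRing.isLinear.Build k H H *:%R (hmul f) (hmul_linearr f).
HB.instance Definition _ g :=
  GRing.isLinear.Build k H H *:%R (hmulr g) (hmul_linearl g).

Lemma hmul_gen F G : hmul (of_forest F) (of_forest G) = of_forest (F ++ G).
Proof. by rewrite /hmul !linext_gen. Qed.

Lemma hmulA : associative hmul.
Proof.
move=> f g h.
apply: (@eq_freemod_linear _ _ _ (hmulr (hmul g h)) (hmulr h \o hmulr g)) => F.
apply: (@eq_freemod_linear _ _ _ (hmul (gen k F) \o hmulr h)
  (hmulr h \o hmul (gen k F))) => G.
rewrite /= /hmulr /=.
apply: (@eq_freemod_linear _ _ _ (hmul (gen k F) \o hmul (gen k G))
  (hmul (hmul (gen k F) (gen k G)))) => L.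
by rewrite /= /hmulr !hmul_gen catA.
Qed.

Lemma hmul1l : left_id (of_forest [::]) hmul.
Proof.
move=> g; apply: (@eq_freemod_linear _ _ _ (hmul (of_forest [::])) idfun) => G.
exact: hmul_gen.
Qed.

Lemma hmul1r : right_id (of_forest [::]) hmul.
Proof.
move=> g; apply: (@eq_freemod_linear _ _ _ (hmulr (of_forest [::])) idfun) => G.
by rewrite /= /hmulr hmul_gen cats0.
Qed.

Lemma hmulDl : left_distributive hmul +%R.
Proof. by move=> f f' g; apply: (linearD (hmulr g)). Qed.

Lemma hmulDr : right_distributive hmul +%R.
Proof. by move=> f g g'; apply: (linearD (hmul f)). Qed.

HB.instance Definition _ := GRing.Zmodule_isPzRing.Build H
  hmulA hmul1l hmul1r hmulDl hmulDr.

(* The left and right actions of [H] on [H ⊗M H]: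
   [a · (b ⊗ c) = (a * b) ⊗ c] and [(b ⊗ c) · a = b ⊗ (c * a)]. *)
Definition lact (a : H) : {linear H ⊗M H -> H ⊗M H} := tmap (hmul a) idfun.
Definition ract (a : H) : {linear H ⊗M H -> H ⊗M H} := tmap idfun (hmulr a).

Lemma lact_tens (a b c : H) : lact a (b ⊗ c) = (a * b) ⊗ c.
Proof. exact: tmap_tens. Qed.

Lemma ract_tens (a b c : H) : ract a (b ⊗ c) = b ⊗ (c * a).
Proof. exact: tmap_tens. Qed.

(* The grafting operator [B_w^+]. *)
Definition graft (w : Omega) : {linear H -> H} :=
  linext (fun F => of_forest [:: Node w F]).

Section DeltaForest.
Variable delta_tree : tree X Omega -> H ⊗M H.

Fixpoint delta_forest_of (F : forest X Omega) : H ⊗M H :=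
  match F with
  | [::] => 0
  | T :: F' =>
      match F' with
      | [::] => delta_tree T
      | _ :: _ => lact (of_forest [:: T]) (delta_forest_of F')
                  + ract (of_forest F') (delta_tree T)
      end
  end.

End DeltaForest.

Fixpoint delta_tree (T : tree X Omega) : H ⊗M H :=
  match T with
  | Leaf _ => (1 : H) ⊗ (1 : H)
  | Node w F => of_forest F ⊗ (1 : H)
                + tmap idfun (graft w) (delta_forest_of delta_tree F)
  end.

Definition Delta_eps : {linear H -> H ⊗M H} :=
  linext (delta_forest_of delta_tree).

Lemma Delta_eps1 : Delta_eps 1 = 0.
Proof. exact: linext_gen. Qed.

Lemma Delta_eps_leaf x :
  Delta_eps (of_forest [:: Leaf x]) = (1 : H) ⊗ (1 : H).
Proof. exact: linext_gen. Qed.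

Lemma Delta_eps_graft w F :
  Delta_eps (graft w (of_forest F)) =
  of_forest F ⊗ (1 : H) + tmap idfun (graft w) (Delta_eps (of_forest F)).
Proof. by rewrite /Delta_eps /= !linext_gen. Qed.

Lemma Delta_eps_cons T F : F != [::] ->
  Delta_eps (of_forest (T :: F)) =
  lact (of_forest [:: T]) (Delta_eps (of_forest F))
  + ract (of_forest F) (Delta_eps (of_forest [:: T])).
Proof. by case: F => // T' F _; rewrite /Delta_eps /= !linext_gen. Qed.

End HRTAlgebra.

Arguments Delta_eps : clear implicits.

(* Main.v *)
From HB Require Import structures.
Require Import Defs.
From mathcomp Require Import all_boot all_algebra.

(** * Coassociativity of an infinitesimal comultiplication on decorated forests

    [Delta_eps] is an infinitesimal derivation,
      [Delta (a b) = a . Delta b + Delta a . b]  for all [a] and [b]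
    ([Delta_epsM]): its recursive definition gives the case where [a] is a
    tree, and associativity spreads it to forests.  The empty forest fits in
    because it is mapped to [0].

    Write [Delta a] as a sum of [a1 ⊗ a2].  At a product, the two sides of the
    coassociativity identity expand to
      [(id ⊗ Delta) Delta (a b)
         = a b1 ⊗ Delta b2  +  a1 ⊗ a2 b1 ⊗ b2  +  a1 ⊗ Delta a2 . b],
      [(Delta ⊗ id) Delta (a b)
         = a . Delta b1 ⊗ b2  +  a1 ⊗ a2 b1 ⊗ b2  +  Delta a1 ⊗ a2 b]
    ([coassoc_leftM], [coassoc_rightM]).  The middle terms agree
    ([cross_term]) and the outer ones are the two sides at [b] and at [a]; so
    the elements where coassociativity holds are closed under products
    ([coassoc_atM]).  They are also closed under grafting
    ([coassoc_at_cocycle]): since [Delta 1 = 0], the rule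
    [Delta (B a) = a ⊗ 1 + (id ⊗ B) (Delta a)] turns each side at [B a] into
    [Delta a ⊗ 1] plus the image by [id ⊗ id ⊗ B] of the same side at [a].
    Both sides vanish at a leaf decorated by [X], whose coproduct is [1 ⊗ 1].
    Mutual induction on trees and forests therefore reaches all forests, which
    span [H]. *)

Set Implicit Arguments.
Unset Strict Implicit.
Unset Printing Implicit Defensive.

Import GRing.Theory.
Local Open Scope ring_scope.

(** * Tensor products of linear maps *)

Section TensorFacts.
Variables (k : comPzRingType).
Implicit Types U V W : lmodType k.

(** The argument order makes [tensr v] a linear map, which can be composed
    with others and placed inside [tmap]. *)
Definition tensr U V (v : V) (u : U) : U ⊗M V := u ⊗ v.

Lemma tensr_is_linear U V (v : V) : linear (@tensr U V v).
Proof. exact: (tens_bilinear _ _).1. Qed.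

HB.instance Definition _ U V (v : V) :=
  GRing.isLinear.Build k U (U ⊗M V) *:%R (@tensr U V v) (tensr_is_linear v).

Lemma tensDl U V (u u' : U) (v : V) : (u + u') ⊗ v = u ⊗ v + u' ⊗ v.
Proof. by have := (tens_bilinear _ _).1 v 1 u u'; rewrite !scale1r. Qed.

Lemma tensDr U V (u : U) (v v' : V) : u ⊗ (v + v') = u ⊗ v + u ⊗ v'.
Proof. by have := (tens_bilinear _ _).2 u 1 v v'; rewrite !scale1r. Qed.

Lemma tens0 U V (u : U) : u ⊗ (0 : V) = 0.
Proof. by apply: (addIr (u ⊗ 0)); rewrite -tensDr !add0r. Qed.

Lemma tmap_linl U V U' V' (f f1 f2 : {linear U -> U'}) (g : {linear V -> V'})
    c t :
  (forall u, f u = c *: f1 u + f2 u) ->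
  tmap f g t = c *: tmap f1 g t + tmap f2 g t.
Proof.
by move=> fE; apply: tlift_lin => u v; rewrite fE (tens_bilinear _ _).1.
Qed.

Lemma tmap_linr U V U' V' (f : {linear U -> U'}) (g g1 g2 : {linear V -> V'})
    c t :
  (forall v, g v = c *: g1 v + g2 v) ->
  tmap f g t = c *: tmap f g1 t + tmap f g2 t.
Proof.
by move=> gE; apply: tlift_lin => u v; rewrite gE (tens_bilinear _ _).2.
Qed.

Lemma eq_tensor3_linear U V W W' (h h' : {linear (U ⊗M V) ⊗M W -> W'}) :
  (forall u v w, h ((u ⊗ v) ⊗ w) = h' ((u ⊗ v) ⊗ w)) -> h =1 h'.
Proof.
move=> eqh; apply: eq_tensor_linear => r w.
apply: (eq_tensor_linear (h := h \o tensr w) (h' := h' \o tensr w)) => u v.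
exact: eqh.
Qed.

(* From here on these maps are only used through their values on pure tensors;
   unification must not unfold them down to representatives of classes. *)
#[local] Opaque tmap tassoc tens.

Lemma tassoc_tmap U V W U' V' W' (f : {linear U -> U'}) (g : {linear V -> V'})
    (h : {linear W -> W'}) t :
  tassoc U' V' W' (tmap (tmap f g) h t) =
  tmap f (tmap g h) (tassoc U V W t).
Proof.
apply: (eq_tensor3_linear (h := tassoc U' V' W' \o tmap (tmap f g) h)
  (h' := tmap f (tmap g h) \o tassoc U V W)) => u v w /=.
by rewrite 2!tmap_tens 2!tassoc_tens 2!tmap_tens.
Qed.

Lemma tmap_comp U V U' V' U'' V'' (f : {linear U -> U'}) (g : {linear V -> V'})
    (f' : {linear U' -> U''}) (g' : {linear V' -> V''}) t :
  tmap f' g' (tmap f g t) = tmap (f' \o f) (g' \o g) t.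
Proof.
apply: (eq_tensor_linear (h := tmap f' g' \o tmap f g)) => u v /=.
by rewrite !tmap_tens.
Qed.

Lemma eq_tmap U V U' V' (f f' : {linear U -> U'}) (g g' : {linear V -> V'}) t :
  f =1 f' -> g =1 g' -> tmap f g t = tmap f' g' t.
Proof.
move=> eqf eqg; apply: eq_tensor_linear => u v.
by rewrite !tmap_tens eqf eqg.
Qed.

Lemma tmap_id U V (t : U ⊗M V) : tmap idfun idfun t = t.
Proof. by apply: (eq_tensor_linear (h' := idfun)) => u v; rewrite tmap_tens. Qed.

Lemma tassoc_tensr U V W (t : U ⊗M V) (w : W) :
  tassoc U V W (t ⊗ w) = tmap idfun (tensr w) t.
Proof.
apply: (eq_tensor_linear (h := tassoc U V W \o tensr w)) => u v /=.
by rewrite tassoc_tens tmap_tens.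
Qed.

End TensorFacts.

#[local] Opaque tmap tassoc tens.

(** * Mutual induction on trees and forests *)

(** The induction principle generated with [tree] says nothing of the branches
    of a node, as they are nested in a list. *)
Lemma tree_forest_ind (X Omega : Type)
    (P : tree X Omega -> Prop) (Q : forest X Omega -> Prop) :
  (forall x, P (Leaf x)) -> (forall w F, Q F -> P (Node w F)) ->
  Q [::] -> (forall T F, P T -> Q F -> Q (T :: F)) ->
  forall F, Q F.
Proof.
move=> Pleaf Pnode Q0 Qcons.
have PT : forall T, P T.
  fix IH 1 => -[x|w F]; first exact: Pleaf.
  by apply: Pnode; elim: F => [|T F IHF] //; apply: Qcons.
by elim=> [|T F IHF] //; apply: Qcons.
Qed.

(** * Infinitesimal derivations

    The product of [A] is given twice, as left and as right multiplication
    operators, so that each partial application is a bundled linear map that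
    [tmap] accepts. *)

Section Derivation.
Variables (k : comPzRingType) (A : lmodType k).
Variables (lmul rmul : A -> {linear A -> A}) (D : {linear A -> A ⊗M A}).
Implicit Types (a b c : A) (s t : A ⊗M A).

Hypothesis lrmul : forall a b, lmul a b = rmul b a.

(** The actions of [A] on [A ⊗M A] as functions of the acting element: in the
    cross term that element runs over one factor of another tensor. *)
Definition lactr s a : A ⊗M A := tmap (lmul a) idfun s.
Definition ractr t b : A ⊗M A := tmap idfun (rmul b) t.

Lemma lactr_is_linear s : linear (lactr s).
Proof. by move=> c a a'; apply: tmap_linl => b; rewrite !lrmul linearP. Qed.

Lemma ractr_is_linear t : linear (ractr t).
Proof. by move=> c b b'; apply: tmap_linr => a; rewrite -!lrmul linearP. Qed.

HB.instance Definition _ s :=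
  GRing.isLinear.Build k A (A ⊗M A) *:%R (lactr s) (lactr_is_linear s).
HB.instance Definition _ t :=
  GRing.isLinear.Build k A (A ⊗M A) *:%R (ractr t) (ractr_is_linear t).

(** Both sides are [a1 ⊗ (a2 b1 ⊗ b2)] when [t] and [s] are the sums of the
    [a1 ⊗ a2] and of the [b1 ⊗ b2]. *)
Lemma cross_term t s :
  tmap idfun (lactr s) t = tassoc A A A (tmap (ractr t) idfun s).
Proof.
(* The left-hand side must be a bundled linear function of [s] before it can be
   tested on pure tensors. *)
pose cross s' := tmap idfun (lactr s') t.
have cross_is_linear : linear cross.
  move=> c s1 s2; apply: tmap_linr => a; exact: linearP.
pose crossL : {linear _ -> _} := HB.pack cross
  (GRing.isLinear.Build k _ _ *:%R cross cross_is_linear).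
apply: (eq_tensor_linear (h := crossL)
  (h' := tassoc A A A \o tmap (ractr t) idfun)) => c d /=.
rewrite tmap_tens /=.
apply: (eq_tensor_linear (h := tmap idfun (lactr (c ⊗ d)))
  (h' := tassoc A A A \o tensr d \o tmap idfun (rmul c))) => u v /=.
by rewrite !tmap_tens /= /lactr /tensr tmap_tens tassoc_tens /= lrmul.
Qed.

(** When [A] is spanned by words multiplied by concatenation, the Leibniz rule
    needs to be known only for splitting off the first letter. *)
Section LeibnizOnWords.
Variables (L : Type) (word : seq L -> A).
Hypothesis word_ext : forall (V : lmodType k) (h h' : {linear A -> V}),
  (forall F, h (word F) = h' (word F)) -> h =1 h'.
Hypothesis word_mul : forall F G, lmul (word F) (word G) = word (F ++ G).
Hypothesis lmulA : forall a b c, lmul (lmul a b) c = lmul a (lmul b c).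
Hypothesis lmul1 : forall a, lmul (word [::]) a = a.
Hypothesis rmul1 : forall a, rmul (word [::]) a = a.
Hypothesis D_nil : D (word [::]) = 0.
Hypothesis D_cons : forall T F, F <> [::] -> D (word (T :: F)) =
  lactr (D (word F)) (word [:: T]) + ractr (D (word [:: T])) (word F).

Lemma lactr1 t : lactr t (word [::]) = t.
Proof. by rewrite -[RHS]tmap_id; apply: eq_tmap. Qed.

Lemma ractr1 t : ractr t (word [::]) = t.
Proof. by rewrite -[RHS]tmap_id; apply: eq_tmap. Qed.

(** The rule persists for one-letter words because [D] kills the empty word. *)
Lemma D_consM T F : D (word (T :: F)) =
  lactr (D (word F)) (word [:: T]) + ractr (D (word [:: T])) (word F).
Proof.
case: F => [|T' F]; last exact: D_cons.
by rewrite ractr1 D_nil /lactr [X in X + _]linear0 add0r.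
Qed.

Lemma lactrD a s t : lactr (s + t) a = lactr s a + lactr t a.
Proof. exact: linearD. Qed.

Lemma ractrD b s t : ractr (s + t) b = ractr s b + ractr t b.
Proof. exact: linearD. Qed.

Lemma lactrM a b t : lactr t (lmul a b) = lactr (lactr t b) a.
Proof.
apply: esym (etrans (tmap_comp _ _ _ _ _) _).
by apply: eq_tmap => [c|//]; rewrite lmulA.
Qed.

Lemma ractrM a b t : ractr t (lmul a b) = ractr (ractr t a) b.
Proof.
apply: esym (etrans (tmap_comp _ _ _ _ _) _).
by apply: eq_tmap => [//|c] /=; rewrite -!lrmul lmulA.
Qed.

Lemma lactr_ractr a b t : lactr (ractr t b) a = ractr (lactr t a) b.
Proof.
apply: etrans (tmap_comp _ _ _ _ _) (esym (etrans (tmap_comp _ _ _ _ _) _)).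
exact: eq_tmap.
Qed.

(** Induction on [F]: associativity of the product and compatibility of the two
    actions redistribute the three terms obtained for a letter, a word and [G].
*)
Lemma derivation_word F G : D (lmul (word F) (word G)) =
  lactr (D (word G)) (word F) + ractr (D (word F)) (word G).
Proof.
elim: F => [|T F IH].
  by rewrite lmul1 lactr1 D_nil /ractr linear0 addr0.
have cons_mul : word (T :: F) = lmul (word [:: T]) (word F) by rewrite word_mul.
rewrite word_mul /= D_consM -word_mul IH (D_consM T F) cons_mul.
apply: etrans (congr2 +%R (lactrD _ _ _) (ractrM _ _ _)) _.
apply: esym; apply: etrans (congr2 +%R (lactrM _ _ _) (ractrD _ _ _)) _.
rewrite -lactr_ractr.
exact: addrA.
Qed.

Lemma derivation_of_words a b :
  D (lmul a b) = lactr (D b) a + ractr (D a) b.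
Proof.
have derl F : D (lmul (word F) b) = lactr (D b) (word F) + ractr (D (word F)) b.
  apply: (word_ext (h := D \o lmul (word F))
    (h' := (tmap (lmul (word F)) idfun \o D) \+ ractr (D (word F)))) => G.
  exact: derivation_word.
rewrite lrmul; apply: (word_ext (h := D \o rmul b)
  (h' := lactr (D b) \+ (tmap idfun (rmul b) \o D))) => F.
by rewrite /= -lrmul derl.
Qed.

End LeibnizOnWords.

Hypothesis derD : forall a b,
  D (lmul a b) = tmap (lmul a) idfun (D b) + tmap idfun (rmul b) (D a).

Definition coassoc_at (a : A) : Prop :=
  tmap idfun D (D a) = tassoc A A A (tmap D idfun (D a)).

Lemma coassoc_at_zero a : D a = 0 -> coassoc_at a.
Proof. by rewrite /coassoc_at => ->; rewrite !linear0. Qed.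

(** Each side applies [D] to one of the factors [e] and [e']. *)
Lemma coassoc_at_tens (e e' a : A) :
  D e = 0 -> D e' = 0 -> D a = e ⊗ e' -> coassoc_at a.
Proof.
rewrite /coassoc_at => De De' ->; rewrite 2!tmap_tens De De'.
by rewrite [LHS]tens0 [0 ⊗ _](linear0 (tensr e')) linear0.
Qed.

Lemma tassoc_tmap_idl (g : {linear A -> A}) s :
  tassoc A A A (tmap D idfun (tmap idfun g s)) =
  tmap idfun (tmap idfun g) (tassoc A A A (tmap D idfun s)).
Proof.
transitivity (tassoc A A A (tmap (tmap idfun idfun) g (tmap D idfun s))).
  2: exact: tassoc_tmap.
congr (tassoc A A A _); rewrite tmap_comp tmap_comp.
by apply: eq_tmap => [u /=|//]; rewrite tmap_id.
Qed.

(** The cross term comes from applying the Leibniz rule to [a2 b], the second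
    factor of [D a . b]. *)
Lemma coassoc_leftM a b :
  tmap idfun D (D (lmul a b)) =
  tmap (lmul a) idfun (tmap idfun D (D b)) + tmap idfun (lactr (D b)) (D a) +
  tmap idfun (tmap idfun (rmul b)) (tmap idfun D (D a)).
Proof.
rewrite derD linearD -addrA; congr (_ + _); first by rewrite !tmap_comp.
apply: (eq_tensor_linear (h := tmap idfun D \o tmap idfun (rmul b))
  (h' := tmap idfun (lactr (D b)) \+
     (tmap idfun (tmap idfun (rmul b)) \o tmap idfun D))) => u v /=.
by rewrite !tmap_tens /= -lrmul derD tensDr.
Qed.

(** The mirror image of [coassoc_leftM]: here the Leibniz rule is applied to
    [a b1], the first factor of [a . D b]. *)
Lemma coassoc_rightM a b :
  tassoc A A A (tmap D idfun (D (lmul a b))) =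
  tmap (lmul a) idfun (tassoc A A A (tmap D idfun (D b))) +
  tassoc A A A (tmap (ractr (D a)) idfun (D b)) +
  tmap idfun (tmap idfun (rmul b)) (tassoc A A A (tmap D idfun (D a))).
Proof.
rewrite derD linearD [tassoc A A A _]linearD /=; congr (_ + _).
  transitivity (tassoc A A A
    (tmap (tmap (lmul a) idfun) idfun (tmap D idfun (D b)) +
     tmap (ractr (D a)) idfun (D b))).
    congr (tassoc A A A _).
    apply: (eq_tensor_linear (h := tmap D idfun \o tmap (lmul a) idfun)
      (h' := (tmap (tmap (lmul a) idfun) idfun \o tmap D idfun) \+
         tmap (ractr (D a)) idfun)) => u v /=.
    by rewrite !tmap_tens /= derD tensDl.
  rewrite [LHS]linearD; congr (_ + _); apply: etrans (tassoc_tmap _ _ _ _) _.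
  by apply: eq_tmap => [//|t]; apply: tmap_id.
exact: tassoc_tmap_idl.
Qed.

Lemma coassoc_atM a b : coassoc_at a -> coassoc_at b -> coassoc_at (lmul a b).
Proof.
rewrite /coassoc_at => eqa eqb.
by rewrite coassoc_leftM coassoc_rightM eqa eqb cross_term.
Qed.

(** The hypothesis on [B] is the cocycle condition satisfied by grafting, with
    [e] the unit.  Since [D e = 0], the term [a ⊗ e] contributes nothing to the
    left-hand side; the summand [D a ⊗ e] that it gives on the right arises on
    the left from applying the condition to the second factor of [D a]. *)
Lemma coassoc_at_cocycle (B : {linear A -> A}) (e : A) a :
  D e = 0 -> (forall b, D (B b) = b ⊗ e + tmap idfun B (D b)) ->
  coassoc_at a -> coassoc_at (B a).
Proof.
rewrite /coassoc_at => De DB eqa; rewrite DB.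
have L1 : tmap idfun D (a ⊗ e) = 0 by rewrite tmap_tens De; exact: tens0.
have L2 : tmap idfun D (tmap idfun B (D a)) =
    tmap idfun (tensr e) (D a) + tmap idfun (tmap idfun B) (tmap idfun D (D a)).
  apply: (eq_tensor_linear (h := tmap idfun D \o tmap idfun B)
    (h' := tmap idfun (tensr e) \+
       (tmap idfun (tmap idfun B) \o tmap idfun D))) => u v /=.
  by rewrite !tmap_tens /= DB tensDr.
have R1 : tassoc A A A (tmap D idfun (a ⊗ e)) = tmap idfun (tensr e) (D a).
  by rewrite tmap_tens tassoc_tensr.
have R2 := tassoc_tmap_idl B (D a).
rewrite [LHS]linearD [tmap D idfun _]linearD [RHS]linearD.
apply: etrans (congr2 +%R L1 L2) _; rewrite add0r eqa.
exact: esym (congr2 +%R R1 R2).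
Qed.

End Derivation.

(** * The coproduct of decorated forests *)

Section Forests.
Variables (k : comPzRingType) (X Omega : choiceType).
Local Notation H := (HRT k X Omega).
Local Notation D := (Delta_eps k X Omega).
Local Notation hmulL := (fun a : H => hmul a : {linear H -> H}).
Local Notation hmulR := (fun b : H => hmulr b : {linear H -> H}).
Local Notation "F %:H" := (of_forest k F) (at level 2, format "F %:H").
Implicit Types (T : tree X Omega) (F G : forest X Omega) (w : Omega).
Implicit Types (a b c : H) (s t : H ⊗M H).

Lemma Delta_epsM a b : D (hmul a b) = lact a (D b) + ract b (D a).
Proof.
have ext (V : lmodType k) (h h' : {linear H -> V}) :
  (forall F, h F%:H = h' F%:H) -> h =1 h' by apply: eq_freemod_linear.
have assoc (a' b' c' : H) := esym (hmulA a' b' c').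
have Dcons T F : F <> [::] -> D (T :: F)%:H =
    lactr hmulL (D F%:H) [:: T]%:H + ractr hmulR (D [:: T]%:H) F%:H.
  by move/eqP; apply: Delta_eps_cons.
exact: (@derivation_of_words k H hmulL hmulR D (fun _ _ => erefl) _
  (@of_forest k X Omega) ext (@hmul_gen _ _ _) assoc
  (@hmul1l _ _ _) (@hmul1r _ _ _) (@Delta_eps1 _ _ _) Dcons).
Qed.

Lemma Delta_eps_graftD w (a : H) :
  D (graft k X w a) = a ⊗ (1 : H) + tmap idfun (graft k X w) (D a).
Proof.
apply: (eq_freemod_linear (h := D \o graft k X w)
  (h' := tensr (1 : H) \+ (tmap idfun (graft k X w) \o D))) => F.
exact: Delta_eps_graft.
Qed.

Lemma coassoc_at_forest F : coassoc_at D F%:H.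
Proof.
elim/(@tree_forest_ind X Omega (fun T => coassoc_at D [:: T]%:H)): F.
- move=> x.
  exact: (coassoc_at_tens (Delta_eps1 k X Omega) (Delta_eps1 k X Omega)
    (Delta_eps_leaf k Omega x)).
- move=> w F cF.
  have <- : graft k X w F%:H = [:: Node w F]%:H by apply: linext_gen.
  exact: (coassoc_at_cocycle (Delta_eps1 k X Omega) (Delta_eps_graftD w)).
- exact: (coassoc_at_zero (Delta_eps1 k X Omega)).
- move=> T F cT cF; have <- : hmul [:: T]%:H F%:H = (T :: F)%:H by apply: hmul_gen.
  exact: (coassoc_atM (lmul := hmulL) (rmul := hmulR)
    (fun _ _ => erefl) (@Delta_epsM) cT cF).
Qed.

End Forests.

Theorem lemma4p14 (k : comPzRingType) (X Omega : choiceType)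
    (hOmega : inhabited Omega) :
  coassociative (Delta_eps k X Omega).
Proof.
apply: (eq_freemod_linear
  (h := tmap idfun (Delta_eps k X Omega) \o Delta_eps k X Omega)
  (h' := tassoc _ _ _ \o tmap (Delta_eps k X Omega) idfun
         \o Delta_eps k X Omega)) => F.
exact: coassoc_at_forest.
Qed.
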